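(* Let $\mathcal{H}$ be a $d$-dimensional complex Hilbert space. For an orthogonal decomposition $\mathrm{P}=\{P_m\}_{m=0}^{M-1}$ of $\mathcal{H}$ and a state $\rho$ on $\mathcal{H}$, put $$C(\rho,\mathrm{P})=1-\sum_{m=0}^{M-1}\mathrm{Tr}\big[(P_m\sqrt{\rho}\,P_m)^2\big].$$ Then for every orthogonal decomposition $\mathrm{P}=\{P_m\}_{m=0}^{M-1}$ of $\mathcal{H}$ the following hold. (C1') Faithfulness: $C(\rho,\mathrm{P})\ge 0$ for every state $\rho$, and $C(\rho,\mathrm{P})=0$ if and only if $\rho\in\mathcal{I}_{\mathrm{P}}$. (C2') Monotonicity: $C(\Phi(\rho),\mathrm{P})\le C(\rho,\mathrm{P})$ for every state $\rho$ and every operation $\Phi$ that is free with respect to $\mathrm{P}$. (C3') Additivity for block-diagonal states: if $p_1,p_2\ge 0$, $p_1+p_2=1$, and $\rho=p_1\rho_1\oplus p_2\rho_2$ is block diagonal with respect to $\mathrm{P}$, then $C(p_1\rho_1\oplus p_2\rho_2,\mathrm{P})=p_1C(\rho_1,\mathrm{P})+p_2C(\rho_2,\mathrm{P})$. (C4') Order-preserving: if $\mathrm{Q}$ is an orthogonal decomposition of $\mathcal{H}$ with $\mathrm{Q}\succeq\mathrm{P}$, then $C(\rho,\mathrm{Q})\ge C(\rho,\mathrm{P})$ for every state $\rho$.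
   Context: A state is a positive semidefinite operator of trace $1$ on $\mathcal{H}$. An orthogonal decomposition of $\mathcal{H}$ is a finite family $\mathrm{P}=\{P_m\}_{m=0}^{M-1}$ of nonzero, mutually orthogonal projections with $\sum_m P_m=I$ (a projective measurement). Free states: $\mathcal{I}_{\mathrm{P}}=\{\rho \text{ a state}: \rho=\sum_m P_m\rho P_m\}$. Free operations: a quantum channel $\Phi$ (completely positive trace-preserving map) on operators on $\mathcal{H}$ is free with respect to $\mathrm{P}$ if it admits a Kraus representation $\Phi(\rho)=\sum_i K_i\rho K_i^\dagger$ such that, for every $i$ and every $\sigma\in\mathcal{I}_{\mathrm{P}}$ with $\mathrm{Tr}(K_i\sigma K_i^\dagger)\neq 0$, one has $K_i\sigma K_i^\dagger/\mathrm{Tr}(K_i\sigma K_i^\dagger)\in\mathcal{I}_{\mathrm{P}}$. Block diagonal: $\rho=p_1\rho_1\oplus p_2\rho_2$ is block diagonal with respect to $\mathrm{P}$ means that there are disjoint subsets $\Lambda_1,\Lambda_2\subseteq\{0,\dots,M-1\}$ such that $\rho=p_1\rho_1+p_2\rho_2$, where $\rho_k$ ($k=1,2$) is a state supported on the subspace $\bigoplus_{m\in\Lambda_k}P_m\mathcal{H}$, i.e. $\rho_k=\Pi_k\rho_k\Pi_k$ with $\Pi_k=\sum_{m\in\Lambda_k}P_m$ (states on these subspaces are regarded as states on $\mathcal{H}$ by extending by zero). Partial order: for orthogonal decompositions $\mathrm{P}=\{P_m\}_{m=0}^{M-1}$ and $\mathrm{Q}=\{Q_n\}_{n=0}^{N-1}$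 of $\mathcal{H}$, $\mathrm{Q}\succeq\mathrm{P}$ (i.e. $\mathrm{Q}$ refines $\mathrm{P}$) means that for every $m$ there is a subset $\Lambda_m\subseteq\{0,\dots,N-1\}$ such that $P_m=\sum_{n\in\Lambda_m}Q_n$. *)

(* Defs.v *)
From HB Require Import structures.
From mathcomp Require Import all_boot all_order all_algebra complex reals.

Set Implicit Arguments.
Unset Strict Implicit.
Unset Printing Implicit Defensive.

Import Order.TTheory GRing.Theory Num.Theory.
Local Open Scope ring_scope.
Local Open Scope sesquilinear_scope.

(* The d-dimensional Hilbert space is the space 'cV[C]_d of column vectors with
   its standard inner product, operators are matrices, and the adjoint is
   A ^t*.  On a numClosedFieldType, 0 <= x asserts that x is real and
   nonnegative, and x <= y asserts the same of y - x. *)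

Definition psdmx (C : numClosedFieldType) (d : nat) (A : 'M[C]_d) : Prop :=
  A \is hermsymmx /\ forall v : 'cV[C]_d, 0 <= (v ^t* *m A *m v) 0 0.

Definition is_state (C : numClosedFieldType) (d : nat) (rho : 'M[C]_d) : Prop :=
  psdmx rho /\ \tr rho = 1.

(* Functional calculus in the orthonormal eigenbasis given by spectralmx; that
   this is the unique positive semidefinite square root is sqrtmxP and
   sqrtmx_unique below. *)
Definition sqrtmx (C : numClosedFieldType) (d : nat) (A : 'M[C]_d) : 'M[C]_d :=
  (spectralmx A) ^t* *m diag_mx (map_mx sqrtC (spectral_diag A))
    *m spectralmx A.

Definition is_projection (C : numClosedFieldType) (d : nat) (P : 'M[C]_d) :
  Prop := P \is hermsymmx /\ P *m P = P.

Definition orthodec (C : numClosedFieldType) (d M : nat) (P : 'I_M -> 'M[C]_d) :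
  Prop :=
  [/\ forall m, is_projection (P m),
      forall m, P m != 0,
      forall m n, m != n -> P m *m P n = 0
    & \sum_m P m = 1%:M].

Definition free_state (C : numClosedFieldType) (d M : nat)
    (P : 'I_M -> 'M[C]_d) (rho : 'M[C]_d) : Prop :=
  is_state rho /\ rho = \sum_m P m *m rho *m P m.

(* id_k (x) Phi: Phi applied to each of the k * k blocks of size d * d. *)
Definition ampliation (C : numClosedFieldType) (d k : nat)
    (Phi : 'M[C]_d -> 'M[C]_d) (X : 'M[C]_(\sum_(i < k) d)) :
    'M[C]_(\sum_(i < k) d) :=
  \mxblock_(i < k, j < k) Phi (submxblock X i j).

Definition completely_positive (C : numClosedFieldType) (d : nat)
    (Phi : 'M[C]_d -> 'M[C]_d) : Prop :=
  forall (k : nat) (X : 'M[C]_(\sum_(i < k) d)),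
    psdmx X -> psdmx (ampliation Phi X).

Definition is_channel (C : numClosedFieldType) (d : nat)
    (Phi : {linear 'M[C]_d -> 'M[C]_d}) : Prop :=
  completely_positive Phi /\ forall X, \tr (Phi X) = \tr X.

Definition is_kraus (C : numClosedFieldType) (d n : nat)
    (K : 'I_n -> 'M[C]_d) (Phi : 'M[C]_d -> 'M[C]_d) : Prop :=
  forall X, Phi X = \sum_i K i *m X *m (K i) ^t*.

Definition free_operation (C : numClosedFieldType) (d M : nat)
    (P : 'I_M -> 'M[C]_d) (Phi : {linear 'M[C]_d -> 'M[C]_d}) : Prop :=
  is_channel Phi /\
  exists n, exists K : 'I_n -> 'M[C]_d,
    is_kraus K Phi /\
    forall i sigma, free_state P sigma ->
      let tau := K i *m sigma *m (K i) ^t* in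
      \tr tau != 0 -> free_state P ((\tr tau)^-1 *: tau).

Definition supported_on (C : numClosedFieldType) (d M : nat)
    (P : 'I_M -> 'M[C]_d) (L : {set 'I_M}) (rho : 'M[C]_d) : Prop :=
  let Pi := \sum_(m in L) P m in rho = Pi *m rho *m Pi.

Definition orthogonal_blocks (C : numClosedFieldType) (d M : nat)
    (P : 'I_M -> 'M[C]_d) (rho1 rho2 : 'M[C]_d) : Prop :=
  exists L1 : {set 'I_M}, exists L2 : {set 'I_M},
    [/\ [disjoint L1 & L2], supported_on P L1 rho1 & supported_on P L2 rho2].

Definition refines (C : numClosedFieldType) (d N M : nat)
    (Q : 'I_N -> 'M[C]_d) (P : 'I_M -> 'M[C]_d) : Prop :=
  forall m, exists L : {set 'I_N}, P m = \sum_(n in L) Q n.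

Definition coherence (C : numClosedFieldType) (d M : nat) (rho : 'M[C]_d)
    (P : 'I_M -> 'M[C]_d) : C :=
  1 - \sum_m \tr ((P m *m sqrtmx rho *m P m) *m (P m *m sqrtmx rho *m P m)).

Lemma psdmx_spectral_ge0 (C : numClosedFieldType) (d : nat) (A : 'M[C]_d) i :
  psdmx A -> 0 <= spectral_diag A 0 i.
Proof.
move=> [hA pA]; have uU := spectral_unitarymx A.
have := pA ((spectralmx A) ^t* *m delta_mx i 0).
have /orthomx_spectralP {2}-> := hermitian_normalmx hA.
rewrite (invmx_unitary uU) trmx_mul map_mxM trmxCK.
rewrite -!mulmxA (mulmxA (spectralmx A)) (unitarymxP uU) mul1mx.
rewrite (mulmxA (spectralmx A)) (unitarymxP uU) mul1mx.
rewrite mul_diag_mx mxE (bigD1 i) //= big1 ?addr0 => [|j ji].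
  by rewrite !mxE !eqxx /= conjC1 mul1r mulr1.
by rewrite !mxE (negPf ji) /= conjC0 mul0r.
Qed.

Lemma sqrtmxP (C : numClosedFieldType) (d : nat) (A : 'M[C]_d) :
  psdmx A -> psdmx (sqrtmx A) /\ sqrtmx A *m sqrtmx A = A.
Proof.
move=> pA; have uU := spectral_unitarymx A.
have s0 i : 0 <= sqrtC (spectral_diag A 0 i).
  by rewrite sqrtC_ge0; exact: psdmx_spectral_ge0.
split; first split.
- apply/is_hermitianmxP; rewrite expr0 scale1r /sqrtmx.
  rewrite !trmx_mul !map_mxM trmxCK tr_diag_mx map_diag_mx -mulmxA.
  congr (_ *m (_ *m _)); congr diag_mx; apply/rowP=> i; rewrite !mxE.
  by apply/esym/CrealP/ger0_real.
- move=> v; rewrite /sqrtmx !mulmxA -(mulmxA _ (spectralmx A) v).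
  set w := spectralmx A *m v.
  have -> : v ^t* *m (spectralmx A) ^t* = w ^t* by rewrite trmx_mul map_mxM.
  rewrite -mulmxA mul_diag_mx mxE sumr_ge0 // => i _.
  by rewrite !mxE mulrCA mulr_ge0 // mulrC mul_conjC_ge0.
have /orthomx_spectralP {3}-> := hermitian_normalmx pA.1.
rewrite (invmx_unitary uU) /sqrtmx !mulmxA mulmxtVK //.
rewrite -(mulmxA _ (diag_mx _) (diag_mx _)) mulmx_diag.
congr (_ *m diag_mx _ *m _); apply/rowP=> i.
by rewrite !mxE -expr2 sqrtCK.
Qed.

Lemma sqrtmx_unique (C : numClosedFieldType) (d : nat) (A S : 'M[C]_d) :
  psdmx A -> psdmx S -> S *m S = A -> S = sqrtmx A.
Proof.
move=> pA pS SS; have [pT TT] := sqrtmxP pA; move: (sqrtmx A) pT TT => T pT TT.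
pose D := S - T.
have hD : D \is hermsymmx.
  apply/is_hermitianmxP; rewrite expr0 scale1r /D linearB /= map_mxB.
  have /is_hermitianmxP := pS.1; rewrite expr0 scale1r => <-.
  by have /is_hermitianmxP := pT.1; rewrite expr0 scale1r => <-.
have uU := spectral_unitarymx D.
have dD : D = (spectralmx D) ^t* *m diag_mx (spectral_diag D) *m spectralmx D.
  have /orthomx_spectralP := hermitian_normalmx hD.
  by rewrite (invmx_unitary uU).
suff z : spectral_diag D = 0.
  by apply/eqP; rewrite -subr_eq0 -/D dD z linear0 mulmx0 mul0mx.
apply/rowP=> i; rewrite [RHS]mxE.
set l := spectral_diag D 0 i.
pose v : 'cV_d := (spectralmx D) ^t* *m delta_mx i 0.
have Dv : D *m v = l *: v.
  rewrite {1}dD /v -!mulmxA (mulmxA (spectralmx D)) (unitarymxP uU) mul1mx.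
  rewrite scalemxAr; congr (_ *m _); apply/colP=> j.
  rewrite mul_diag_mx !mxE eqxx andbT.
  by case: eqP => [->|]; rewrite ?mulr0.
have vv : (v ^t* *m v) 0 0 = 1.
  rewrite /v trmx_mul map_mxM trmxCK -mulmxA (mulmxA (spectralmx D)).
  rewrite (unitarymxP uU) mul1mx.
  rewrite mxE (bigD1 i) //= big1 ?addr0 => [|j ji].
    by rewrite !mxE !eqxx conjC1 mulr1.
  by rewrite !mxE (negPf ji) /= mulr0.
have lR : l^* = l.
  have /mxOverP/(_ 0 i) := hermitian_spectral_diag_real hD.
  by move/CrealP.
have vD : v ^t* *m D = l *: v ^t*.
  have /is_hermitianmxP := hD; rewrite expr0 scale1r => {1}->.
  by rewrite -map_mxM -trmx_mul Dv linearZ /= map_mxZ; congr (_ *: _).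
have E : S *m D + D *m T = 0.
  by rewrite /D mulmxBr mulmxBl SS TT addrA subrK subrr.
have : l * ((v ^t* *m S *m v) 0 0 + (v ^t* *m T *m v) 0 0) = 0.
  have := congr1 (fun X => (v ^t* *m X *m v) 0 0) E.
  have -> : v ^t* *m (S *m D + D *m T) *m v
            = l *: (v ^t* *m S *m v + v ^t* *m T *m v).
    rewrite mulmxDr mulmxDl (mulmxA _ D) vD -scalemxAl -scalemxAl.
    by rewrite -mulmxA -(mulmxA S) Dv -!scalemxAr scalerDr !mulmxA.
  by rewrite mulmx0 mul0mx mxE [in RHS]mxE [in X in _ * X]mxE.
move/eqP; rewrite mulf_eq0 => /orP[/eqP //|].
rewrite paddr_eq0 ?(pS.2) ?(pT.2) // => /andP[/eqP s0 /eqP t0].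
have : (v ^t* *m D *m v) 0 0 = 0.
  by rewrite /D mulmxBr mulmxBl mxE s0 mxE t0 subrr.
by rewrite vD -scalemxAl mxE vv mulr1.
Qed.

(* Main.v *)
Require Import Defs.
From HB Require Import structures.
From mathcomp Require Import all_boot all_order all_algebra complex reals.
From mathcomp Require Import ring.
Set Implicit Arguments.
Unset Strict Implicit.
Unset Printing Implicit Defensive.
Import Order.TTheory GRing.Theory Num.Theory.
Local Open Scope ring_scope.
Local Open Scope sesquilinear_scope.

(** Write [Delta X] for [\sum_m P_m X P_m] and [S] for the square root of [rho].
    Since [Delta] is an orthogonal projection for the Hilbert-Schmidt product,
    [coherence rho P = 1 - |Delta S|^2 = |S - Delta S|^2], and everything except
    monotonicity is read off this formula and the uniqueness of square roots.

    Monotonicity rests on the affinity [\tr (sqrt A * sqrt B)], which a channel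
    does not decrease.  Take [A = rho] and [B = (Delta S)^2], a multiple of a
    free state.  Then [Phi B] is again block diagonal, so its square root [E]
    satisfies [Delta E = E], and with [X] the square root of [Phi rho]
    [2 |Delta S|^2 <= 2 \tr (X E) <= |Delta X|^2 + |E|^2], where
    [|E|^2 = |Delta S|^2]. *)

(** * Adjoints of matrices *)

Lemma adjmxM (C : numClosedFieldType) (m n p : nat)
    (A : 'M[C]_(m, n)) (B : 'M[C]_(n, p)) :
  (A *m B) ^t* = B ^t* *m A ^t*.
Proof. by rewrite trmx_mul map_mxM. Qed.

Lemma adjmxD (C : numClosedFieldType) (m n : nat) (A B : 'M[C]_(m, n)) :
  (A + B) ^t* = A ^t* + B ^t*.
Proof. by rewrite linearD map_mxD. Qed.

Lemma adjmxB (C : numClosedFieldType) (m n : nat) (A B : 'M[C]_(m, n)) :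
  (A - B) ^t* = A ^t* - B ^t*.
Proof. by rewrite linearB map_mxB. Qed.

Lemma adjmxZ (C : numClosedFieldType) (m n : nat) a (A : 'M[C]_(m, n)) :
  (a *: A) ^t* = a^* *: A ^t*.
Proof. by rewrite linearZ /= map_mxZ. Qed.

Lemma adjmx_sum (C : numClosedFieldType) (m n : nat) (I : Type) (r : seq I)
    (Q : pred I) (F : I -> 'M[C]_(m, n)) :
  (\sum_(i <- r | Q i) F i) ^t* = \sum_(i <- r | Q i) (F i) ^t*.
Proof. by rewrite linear_sum map_mx_sum. Qed.

Lemma adjmx1 (C : numClosedFieldType) (n : nat) : (1%:M : 'M[C]_n) ^t* = 1%:M.
Proof. by rewrite trmx1 map_mx1. Qed.

Lemma adjmx0 (C : numClosedFieldType) (m n : nat) :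
  (0 : 'M[C]_(m, n)) ^t* = 0.
Proof. by rewrite trmx0 map_mx0. Qed.

Lemma mxtrace_adj (C : numClosedFieldType) (n : nat) (A : 'M[C]_n) :
  \tr (A ^t*) = (\tr A)^*.
Proof. by rewrite /mxtrace rmorph_sum; apply: eq_bigr => i _; rewrite !mxE. Qed.

Lemma hermsymmxP (C : numClosedFieldType) (n : nat) (A : 'M[C]_n) :
  A \is hermsymmx <-> A ^t* = A.
Proof.
split=> [/is_hermitianmxP|h]; first by rewrite expr0 scale1r.
by apply/is_hermitianmxP; rewrite expr0 scale1r h.
Qed.

(** * The Hilbert-Schmidt inner product *)

Definition hsdot (C : numClosedFieldType) (d : nat) (X Y : 'M[C]_d) : C :=
  \tr (X ^t* *m Y).

Section HilbertSchmidt.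
Variables (C : numClosedFieldType) (d : nat).
Implicit Types X Y Z : 'M[C]_d.

Lemma hsdotC X Y : hsdot X Y = (hsdot Y X)^*.
Proof. by rewrite /hsdot -mxtrace_adj adjmxM trmxCK. Qed.

Lemma hsdotBr X Y Z : hsdot X (Y - Z) = hsdot X Y - hsdot X Z.
Proof. by rewrite /hsdot mulmxBr linearB. Qed.

Lemma hsdotBl X Y Z : hsdot (X - Y) Z = hsdot X Z - hsdot Y Z.
Proof. by rewrite /hsdot adjmxB mulmxBl linearB. Qed.

Lemma hsdotZr a X Y : hsdot X (a *: Y) = a * hsdot X Y.
Proof. by rewrite /hsdot -scalemxAr linearZ. Qed.

Lemma hsdotZl a X Y : hsdot (a *: X) Y = a^* * hsdot X Y.
Proof. by rewrite /hsdot adjmxZ -scalemxAl linearZ. Qed.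

Lemma hsdotxxE X : hsdot X X = \sum_i \sum_j `|X i j| ^+ 2.
Proof.
rewrite exchange_big; apply: eq_bigr => i _; rewrite mxE.
by apply: eq_bigr => j _; rewrite !mxE mulrC -normCK.
Qed.

Lemma hsdotxx_ge0 X : 0 <= hsdot X X.
Proof.
rewrite hsdotxxE; apply: sumr_ge0 => i _; apply: sumr_ge0 => j _.
exact: exprn_ge0.
Qed.

Lemma hsdotxx_eq0 X : hsdot X X = 0 -> X = 0.
Proof.
have sq_ge0 (i j : 'I_d) : 0 <= `|X i j| ^+ 2 by exact: exprn_ge0.
move/eqP; rewrite hsdotxxE psumr_eq0 => [/allP h|i _]; last exact: sumr_ge0.
apply/matrixP=> i j; rewrite mxE.
have := h i (mem_index_enum i); rewrite /= psumr_eq0 // => /allP h'.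
by have := h' j (mem_index_enum j); rewrite /= sqrf_eq0 normr_eq0 => /eqP.
Qed.

Lemma hsdotBB X Y :
  hsdot (X - Y) (X - Y) = hsdot X X - hsdot X Y - hsdot Y X + hsdot Y Y.
Proof. by rewrite hsdotBl !hsdotBr; ring. Qed.

Lemma hsdot_le_mean X Y : hsdot X Y + hsdot Y X <= hsdot X X + hsdot Y Y.
Proof.
rewrite -subr_ge0; have := hsdotxx_ge0 (X - Y); rewrite hsdotBB.
by congr (0 <= _); ring.
Qed.

End HilbertSchmidt.

(** * Positive semidefinite matrices and their square roots *)

Section PositiveSemidefinite.
Variables (C : numClosedFieldType) (d : nat).
Implicit Types A B K S X : 'M[C]_d.

Lemma psdmx_adj A : psdmx A -> A ^t* = A.
Proof. by case=> /hermsymmxP. Qed.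

Lemma psdmx_gram X : psdmx (X ^t* *m X).
Proof.
split=> [|v]; first by apply/hermsymmxP; rewrite adjmxM trmxCK.
rewrite mulmxA -adjmxM -mulmxA mxE sumr_ge0 // => i _.
by rewrite !mxE mulrC mul_conjC_ge0.
Qed.

Lemma psdmx_sqr A : A ^t* = A -> psdmx (A *m A).
Proof. by move=> hA; have := psdmx_gram A; rewrite hA. Qed.

Lemma psdmx_conj A K : psdmx A -> psdmx (K *m A *m K ^t*).
Proof.
move=> pA; split=> [|v].
  by apply/hermsymmxP; rewrite !adjmxM trmxCK (psdmx_adj pA) mulmxA.
have := pA.2 (K ^t* *m v); rewrite adjmxM trmxCK.
by congr (0 <= fun_of_matrix _ _ _); rewrite !mulmxA.
Qed.

Lemma psdmxD A B : psdmx A -> psdmx B -> psdmx (A + B).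
Proof.
move=> pA pB; split=> [|v].
  by apply/hermsymmxP; rewrite adjmxD !psdmx_adj.
by rewrite mulmxDr mulmxDl mxE addr_ge0 ?pA.2 ?pB.2.
Qed.

Lemma psdmxZ a A : 0 <= a -> psdmx A -> psdmx (a *: A).
Proof.
move=> a0 pA; split=> [|v].
  by apply/hermsymmxP; rewrite adjmxZ psdmx_adj // geC0_conj.
by rewrite -scalemxAr -scalemxAl mxE mulr_ge0 ?pA.2.
Qed.

Lemma psdmx0 : psdmx (0 : 'M[C]_d).
Proof. by have := psdmx_gram 0; rewrite mulmx0. Qed.

Lemma psdmx_scalar a : 0 <= a -> psdmx (a%:M : 'M[C]_d).
Proof.
move=> a0; rewrite -scalemx1; apply: psdmxZ => //.
by have := psdmx_gram 1%:M; rewrite adjmx1 mulmx1.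
Qed.

Lemma psdmx_sum (I : Type) (r : seq I) (Q : pred I) (F : I -> 'M[C]_d) :
  (forall i, psdmx (F i)) -> psdmx (\sum_(i <- r | Q i) F i).
Proof. by move=> pF; apply: big_ind => //; [exact: psdmx0|exact: psdmxD]. Qed.

Lemma psdmx_sqrt A : psdmx A -> psdmx (sqrtmx A).
Proof. by case/sqrtmxP. Qed.

Lemma sqrtmxK A : psdmx A -> sqrtmx A *m sqrtmx A = A.
Proof. by case/sqrtmxP. Qed.

Lemma sqrtmx_adj A : psdmx A -> (sqrtmx A) ^t* = sqrtmx A.
Proof. by move/psdmx_sqrt/psdmx_adj. Qed.

Lemma hsdot_sqrtmx A : psdmx A -> hsdot (sqrtmx A) (sqrtmx A) = \tr A.
Proof. by move=> pA; rewrite /hsdot sqrtmx_adj // sqrtmxK. Qed.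

Lemma psdmx_tr_ge0 A : psdmx A -> 0 <= \tr A.
Proof. by move/hsdot_sqrtmx <-; exact: hsdotxx_ge0. Qed.

Lemma psdmx_tr_eq0 A : psdmx A -> \tr A = 0 -> A = 0.
Proof.
move=> pA; rewrite -hsdot_sqrtmx // => /hsdotxx_eq0 s0.
by rewrite -(sqrtmxK pA) s0 mulmx0.
Qed.

(** With [S], [T] the square roots of [A], [B], the value is the squared norm of [S X T]. *)
Lemma hsdot_psdmx_ge0 A B X : psdmx A -> psdmx B -> 0 <= hsdot X (A *m X *m B).
Proof.
move=> pA pB; have := sqrtmxK pB; have := sqrtmxK pA.
move: (sqrtmx A) (sqrtmx B) (sqrtmx_adj pA) (sqrtmx_adj pB) => S T hS hT SS TT.
have := hsdotxx_ge0 (S *m X *m T).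
by rewrite /hsdot !adjmxM hS hT -mulmxA mxtrace_mulC -SS -TT !mulmxA.
Qed.

(** Conjugating the square root by [U] gives a positive semidefinite square root of [U A U = A], so
    uniqueness applies. *)
Lemma sqrtmx_comm A U : psdmx A -> U ^t* = U -> U *m U = 1%:M ->
  U *m A = A *m U -> U *m sqrtmx A = sqrtmx A *m U.
Proof.
move=> pA hU UU cUA.
suff E : U *m sqrtmx A *m U = sqrtmx A by rewrite -[in RHS]E -mulmxA UU mulmx1.
apply: sqrtmx_unique => //.
  by rewrite -{2}hU; apply/psdmx_conj/psdmx_sqrt.
move: (sqrtmx A) (sqrtmxK pA) => S SS.
rewrite !mulmxA -(mulmxA _ U U) UU mulmx1 -(mulmxA U) SS.
by rewrite cUA -mulmxA UU mulmx1.
Qed.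

(** The reflection [1 - 2 Q] is a hermitian involution, and commuting with it amounts to commuting
    with [Q]. *)
Lemma sqrtmx_comm_proj A Q : psdmx A -> is_projection Q ->
  Q *m A = A *m Q -> Q *m sqrtmx A = sqrtmx A *m Q.
Proof.
move=> pA [/hermsymmxP hQ QQ] cQA.
pose U := 1%:M - 2%:R *: Q.
have : U *m sqrtmx A = sqrtmx A *m U.
  apply: sqrtmx_comm => //.
  - by rewrite adjmxB adjmx1 adjmxZ hQ conjC_nat.
  - rewrite /U mulmxBl mul1mx mulmxBr mulmx1 -scalemxAr -!scalemxAl QQ.
    by rewrite [2%:R *: (_ *: _)]scaler_nat mulr2n opprB addrK subrK.
  - by rewrite /U mulmxBl mulmxBr mul1mx mulmx1 -scalemxAl -scalemxAr cQA.
rewrite /U mulmxBl mulmxBr mul1mx mulmx1 -scalemxAl -scalemxAr.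
move=> /addrI/oppr_inj.
by apply: scalerI; rewrite pnatr_eq0.
Qed.

End PositiveSemidefinite.

(** * The pinching map of an orthogonal decomposition *)

Definition pinching (C : numClosedFieldType) (d M : nat)
    (P : 'I_M -> 'M[C]_d) (X : 'M[C]_d) : 'M[C]_d :=
  \sum_m P m *m X *m P m.

Lemma mxtrace_sandwich (C : numClosedFieldType) (d : nat) (Q S : 'M[C]_d) :
  Q *m Q = Q ->
  \tr (Q *m S *m Q *m (Q *m S *m Q)) = \tr (Q *m S *m Q *m S).
Proof.
move=> QQ; rewrite !mulmxA -(mulmxA _ Q Q) QQ mxtrace_mulC.
by rewrite !mulmxA QQ.
Qed.

Section Pinching.
Variables (C : numClosedFieldType) (d M : nat) (P : 'I_M -> 'M[C]_d).
Hypothesis hP : orthodec P.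
Implicit Types X Y rho : 'M[C]_d.

Lemma orthodec_adj m : (P m) ^t* = P m.
Proof. by case: hP => /(_ m)[/hermsymmxP]. Qed.

Lemma orthodec_mulmx m n : P m *m P n = (m == n)%:R *: P m.
Proof.
case: hP => pP _ oP _; case: eqP => [<-|/eqP/oP->]; last by rewrite scale0r.
by rewrite scale1r (pP m).2.
Qed.

Lemma pinching_mull m X : P m *m pinching P X = P m *m X *m P m.
Proof.
rewrite mulmx_sumr (bigD1 m) //= !mulmxA orthodec_mulmx eqxx scale1r.
rewrite big1 ?addr0 // => n nm.
by rewrite !mulmxA orthodec_mulmx eq_sym (negPf nm) scale0r !mul0mx.
Qed.

Lemma pinching_mulr m X : pinching P X *m P m = P m *m X *m P m.
Proof.
rewrite mulmx_suml (bigD1 m) //= -mulmxA orthodec_mulmx eqxx scale1r.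
rewrite big1 ?addr0 // => n nm.
by rewrite -mulmxA orthodec_mulmx (negPf nm) scale0r mulmx0.
Qed.

Lemma pinching_comm m X : P m *m pinching P X = pinching P X *m P m.
Proof. by rewrite pinching_mull pinching_mulr. Qed.

(** Commutation is the form of block diagonality that passes to products and to square roots. *)
Lemma pinching_fixP X :
  X = pinching P X <-> forall m, P m *m X = X *m P m.
Proof.
split=> [-> m|cX]; first exact: pinching_comm.
case: (hP) => _ _ _ P1; rewrite /pinching.
under eq_bigr do rewrite cX -mulmxA orthodec_mulmx eqxx scale1r.
by rewrite -mulmx_sumr P1 mulmx1.
Qed.

Lemma pinchingK X : pinching P (pinching P X) = pinching P X.
Proof. by apply/esym/pinching_fixP => m; exact: pinching_comm. Qed.

Lemma pinching_adj X : (pinching P X) ^t* = pinching P (X ^t*).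
Proof.
rewrite adjmx_sum; apply: eq_bigr => m _.
by rewrite !adjmxM orthodec_adj mulmxA.
Qed.

Lemma pinching_psdmx X : psdmx X -> psdmx (pinching P X).
Proof.
move=> pX; apply: psdmx_sum => m.
by rewrite -[X in _ *m X]orthodec_adj; exact: psdmx_conj.
Qed.

Lemma hsdot_pinchingr X Y : hsdot X (pinching P Y) = hsdot (pinching P X) Y.
Proof.
rewrite /hsdot pinching_adj mulmx_sumr mulmx_suml !linear_sum.
by apply: eq_bigr => m _; rewrite /= !mulmxA mxtrace_mulC !mulmxA.
Qed.

Lemma hsdot_pinching X Y :
  hsdot (pinching P X) (pinching P Y) = hsdot (pinching P X) Y.
Proof. by rewrite hsdot_pinchingr pinchingK. Qed.

(** * Faithfulness, refinement and block additivity of the coherence *)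

Lemma coherenceE rho : psdmx rho ->
  coherence rho P = 1 - hsdot (pinching P (sqrtmx rho)) (sqrtmx rho).
Proof.
move=> p; rewrite /coherence; have := sqrtmx_adj p.
move: (sqrtmx rho) => S hS; congr (1 - _).
rewrite /hsdot pinching_adj hS mulmx_suml linear_sum /=; apply: eq_bigr => m _.
by rewrite mxtrace_sandwich // orthodec_mulmx eqxx scale1r.
Qed.

Lemma coherence_dist rho : is_state rho ->
  let S := sqrtmx rho in
  coherence rho P = hsdot (S - pinching P S) (S - pinching P S).
Proof.
(* The constant [1] becomes [\tr rho], the squared norm of [S], and the claim is Pythagoras for the
   projection [pinching P]. *)
move=> [p t] S; rewrite coherenceE // -/S -t -hsdot_sqrtmx // -/S hsdotBB.
by rewrite hsdot_pinchingr hsdot_pinching; ring.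
Qed.

Lemma sqrtmx_pinching_fix rho : psdmx rho -> rho = pinching P rho ->
  sqrtmx rho = pinching P (sqrtmx rho).
Proof.
move=> p /pinching_fixP cP; apply/pinching_fixP => m.
by apply: sqrtmx_comm_proj => //; case: hP.
Qed.

Lemma coherence_ge0 rho : is_state rho -> 0 <= coherence rho P.
Proof. by move/coherence_dist->; exact: hsdotxx_ge0. Qed.

Lemma coherence_eq0P rho : is_state rho ->
  coherence rho P = 0 <-> free_state P rho.
Proof.
move=> sr; rewrite coherence_dist //; split=> [/hsdotxx_eq0/eqP|[_ fr]].
  rewrite subr_eq0 => /eqP/pinching_fixP; have := sqrtmxK sr.1.
  move: (sqrtmx rho) => S SS cS; split=> //; apply/pinching_fixP => m.
  by rewrite -SS mulmxA cS -!mulmxA cS.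
rewrite -(sqrtmx_pinching_fix sr.1 fr) subrr.
by rewrite /hsdot mulmx0 mxtrace0.
Qed.

(** Expanding [P m] over [L m] turns [\tr (P m S P m S)] into a double sum of squared norms of
    [Q n' S Q n]; keeping only its diagonal [n = n'] leaves the terms that belong to [Q]. *)
Lemma coherence_refines (N : nat) (Q : 'I_N -> 'M[C]_d) rho :
  (forall n, Q n != 0) -> (forall n, (Q n) ^t* = Q n) ->
  (forall m n, Q m *m Q n = (m == n)%:R *: Q m) ->
  refines Q P -> psdmx rho -> coherence rho P <= coherence rho Q.
Proof.
move=> Q0 hQ oQ /fin_all_exists[L PL] p; rewrite /coherence lerD2l lerN2.
have := sqrtmx_adj p; move: (sqrtmx rho) => S hS.
have QQ n : Q n *m Q n = Q n by rewrite oQ eqxx scale1r.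
have tQ_ge0 n n' : 0 <= \tr (Q n *m S *m Q n' *m S).
  have := hsdotxx_ge0 (Q n' *m S *m Q n).
  rewrite /hsdot !adjmxM hS !hQ !mulmxA -(mulmxA _ (Q n') (Q n')) QQ.
  by rewrite mxtrace_mulC !mulmxA QQ.
have leP m : \sum_(n in L m) \tr (Q n *m S *m Q n *m S)
    <= \tr (P m *m S *m P m *m S).
  rewrite PL !mulmx_suml linear_sum /=; apply: ler_sum => n nL.
  rewrite mulmx_sumr mulmx_suml linear_sum /= (bigD1 n) //= lerDl.
  exact: sumr_ge0.
under eq_bigr do rewrite mxtrace_sandwich ?QQ //.
under [leRHS]eq_bigr do
  rewrite mxtrace_sandwich ?orthodec_mulmx ?eqxx ?scale1r //.
have : \sum_m \sum_(n in L m) \tr (Q n *m S *m Q n *m S)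
    <= \sum_m \tr (P m *m S *m P m *m S) by apply: ler_sum => m _; exact: leP.
apply: le_trans.
rewrite [leRHS](exchange_big_dep xpredT) //=; apply: ler_sum => n _.
(* Otherwise [Q n] annihilates every [P m], hence the identity, contradicting [Q n != 0]. *)
have [m nLm] : exists m, n \in L m.
  apply/existsP; apply: contraNT (Q0 n); rewrite negb_exists => /forallP nL.
  case: hP => _ _ _ P1; rewrite -[Q n]mulmx1 -P1 mulmx_sumr big1 // => m _.
  rewrite PL mulmx_sumr big1 // => n' n'L; rewrite oQ.
  by case: eqP n'L => [<-|_ _]; [rewrite (negPf (nL m))|rewrite scale0r].
by rewrite (bigD1 m) //= lerDl sumr_ge0.
Qed.

(** The squared norm of [S P m], with [S] the root of [rho], is [\tr (P m rho P m)], and [P m] is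
    orthogonal to the support projection. *)
Lemma supported_sqrtmx (L : {set 'I_M}) rho : psdmx rho ->
  supported_on P L rho -> forall m, m \notin L ->
  sqrtmx rho *m P m = 0 /\ P m *m sqrtmx rho = 0.
Proof.
move=> p sup m mL; suff S0 : sqrtmx rho *m P m = 0.
  split=> //; apply: (can_inj (@trmxCK _ _ _)).
  by rewrite adjmxM orthodec_adj sqrtmx_adj // S0 adjmx0.
have := sqrtmxK p; have := sqrtmx_adj p; move: (sqrtmx rho) => S hS SS.
have Pi0 : (\sum_(n in L) P n) *m P m = 0.
  rewrite mulmx_suml big1 // => n nL; rewrite orthodec_mulmx.
  by case: eqP nL mL => [->->|]; rewrite ?scale0r.
apply: hsdotxx_eq0; rewrite /hsdot adjmxM hS -mulmxA (mulmxA S) SS.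
by rewrite sup -(mulmxA _ _ (P m)) Pi0 !mulmx0 mxtrace0.
Qed.

(** The roots of the two blocks have product zero in both orders, so the root of the mixture is
    their combination with weights [sqrtC p1], [sqrtC p2]. Each [P m] then meets at most one of the
    two roots, and squaring restores the weights. *)
Lemma coherence_block (p1 p2 : C) (rho1 rho2 : 'M[C]_d) :
  0 <= p1 -> 0 <= p2 -> p1 + p2 = 1 -> psdmx rho1 -> psdmx rho2 ->
  orthogonal_blocks P rho1 rho2 ->
  coherence (p1 *: rho1 + p2 *: rho2) P =
    p1 * coherence rho1 P + p2 * coherence rho2 P.
Proof.
move=> p1_ge0 p2_ge0 p12 ps1 ps2 [L1 [L2 [dL sup1 sup2]]].
have z1 := supported_sqrtmx ps1 sup1; have z2 := supported_sqrtmx ps2 sup2.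
have zz m : m \notin L1 \/ m \notin L2.
  by have [/(disjointFr dL)->|] := boolP (m \in L1); [right|left].
have P1 : \sum_m P m = 1%:M by case: hP.
have q1 := psdmx_sqrt ps1; have q2 := psdmx_sqrt ps2.
have h1 := sqrtmx_adj ps1; have h2 := sqrtmx_adj ps2.
have e1 := sqrtmxK ps1; have e2 := sqrtmxK ps2.
have E : sqrtC p1 *: sqrtmx rho1 + sqrtC p2 *: sqrtmx rho2
    = sqrtmx (p1 *: rho1 + p2 *: rho2).
  apply: sqrtmx_unique; first by apply: psdmxD; exact: psdmxZ.
    by apply: psdmxD; apply: psdmxZ; rewrite ?sqrtC_ge0.
  move: (sqrtmx rho1) (sqrtmx rho2) z1 z2 e1 e2 h1 h2 {q1 q2}.
  move=> S T z1 z2 e1 e2 h1 h2.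
  (* Inserting the sum of the [P m] between [S] and [T], every term has a factor [S P m] or [P m T]
     that vanishes. *)
  have o12 : S *m T = 0.
    rewrite -[S]mulmx1 -P1 mulmx_sumr mulmx_suml big1 // => m _.
    by case: (zz m) => [/z1[-> _]|/z2[_ h]];
      rewrite ?mul0mx // -mulmxA h mulmx0.
  have o21 : T *m S = 0.
    by apply: (can_inj (@trmxCK _ _ _)); rewrite adjmxM h1 h2 o12 adjmx0.
  rewrite mulmxDl !mulmxDr -!scalemxAl -!scalemxAr o12 o21 !scaler0 addr0 add0r.
  by rewrite e1 e2 !scalerA -!expr2 !sqrtCK.
rewrite /coherence -E.
move: (sqrtmx rho1) (sqrtmx rho2) z1 z2 {E e1 e2 h1 h2 q1 q2} => S T z1 z2.
rewrite !mulrBr !mulr1 addrACA p12 -opprD; congr (1 - _).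
rewrite !mulr_sumr -big_split /=; apply: eq_bigr => m _.
rewrite mulmxDr mulmxDl -!scalemxAr -!scalemxAl.
by case: (zz m) => [/z1[_ ->]|/z2[_ ->]]; rewrite !mul0mx mxtrace0 scaler0 mulr0
   ?add0r ?addr0 -scalemxAl -scalemxAr scalerA -expr2 sqrtCK linearZ.
Qed.

End Pinching.

(** * Nonnegativity of self-adjoint maps on matrices from their eigenvalues *)

Lemma hermsymmx_eigen_ge0 (C : numClosedFieldType) (n : nat) (H : 'M[C]_n) :
  H ^t* = H ->
  (forall (v : 'rV_n) a,
     a \is Num.real -> v != 0 -> v *m H = a *: v -> 0 <= a) ->
  forall w : 'rV_n, 0 <= (w *m H *m w ^t*) 0 0.
Proof.
move=> /hermsymmxP hH eig w; have uU := spectral_unitarymx H.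
have /mxOverP rD := hermitian_spectral_diag_real hH.
have dH : H = (spectralmx H) ^t* *m diag_mx (spectral_diag H) *m spectralmx H.
  have /orthomx_spectralP := hermitian_normalmx hH.
  by rewrite (invmx_unitary uU).
move: (spectralmx H) (spectral_diag H) uU rD dH => U D /unitarymxP UU rD dH.
(* The rows of [U] are left eigenvectors of [H], nonzero because [U] is unitary. *)
have D_ge0 i : 0 <= D 0 i.
  apply: (eig (row i U)); first exact: rD.
    apply/eqP => ri0.
    have : row i (U *m U ^t*) = 0 by rewrite row_mul ri0 mul0mx.
    by rewrite UU => /rowP/(_ i)/eqP; rewrite !mxE eqxx oner_eq0.
  rewrite -row_mul dH !mulmxA UU mul1mx mul_diag_mx.
  by apply/rowP=> j; rewrite !mxE.
have -> : w *m H *m w ^t* = (w *m U ^t*) *m diag_mx D *m (w *m U ^t*) ^t*.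
  by rewrite dH adjmxM trmxCK !mulmxA.
rewrite mxE sumr_ge0 // => i _; rewrite mul_mx_diag !mxE.
by rewrite mulrAC mulr_ge0 // mul_conjC_ge0.
Qed.

Lemma mxvec_hsdot (C : numClosedFieldType) (d : nat) (X Y : 'M[C]_d) :
  (mxvec X *m (mxvec Y) ^t*) 0 0 = hsdot Y X.
Proof.
rewrite mxE (reindex _ (curry_mxvec_bij _ _)) /=.
transitivity (\sum_(p : 'I_d * 'I_d) X p.1 p.2 * (Y p.1 p.2)^*).
  by apply: eq_bigr => -[i j] _; rewrite !mxE !mxvecE.
rewrite -(pair_bigA _ (fun i j => X i j * (Y i j)^*)) exchange_big /=.
apply: eq_bigr => i _; rewrite mxE; apply: eq_bigr => j _.
by rewrite !mxE mulrC.
Qed.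

(** Vectorisation by [mxvec] represents [f] by a matrix of size [d * d], hermitian because [f] is
    self-adjoint for [hsdot]; the spectral criterion for matrices then applies. *)
Lemma hsdot_eigen_ge0 (C : numClosedFieldType) (d : nat)
    (f : 'M[C]_d -> 'M[C]_d) :
  linear f -> (forall X Y, hsdot X (f Y) = hsdot (f X) Y) ->
  (forall V a, a \is Num.real -> V != 0 -> f V = a *: V -> 0 <= a) ->
  forall W, 0 <= hsdot W (f W).
Proof.
move=> lf sf eig W.
pose g : {linear 'M[C]_d -> 'M[C]_d} :=
  HB.pack f (GRing.isLinear.Build _ _ _ _ f lf).
have gE V : mxvec V *m lin_mx g = mxvec (f V) by rewrite mul_vec_lin.
rewrite -mxvec_hsdot -gE; apply: hermsymmx_eigen_ge0 => [|v a ra v0].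
  suff E (u v : 'rV[C]_(d * d)) :
      (u *m (lin_mx g) ^t* *m v ^t*) 0 0 = (u *m lin_mx g *m v ^t*) 0 0.
    apply/matrixP => i j; have := E (delta_mx 0 i) (delta_mx 0 j).
    have -> : (delta_mx 0 j : 'rV[C]_(d * d)) ^t* = delta_mx j 0.
      by apply/matrixP => k l; rewrite !mxE conjC_nat andbC.
    by rewrite -!rowE -!colE !mxE.
  rewrite -mulmxA -adjmxM -[u]vec_mxK -[v]vec_mxK !gE !mxvec_hsdot.
  exact/esym/sf.
rewrite -[v]vec_mxK gE -linearZ => /(can_inj mxvecK); apply: eig => //.
by rewrite -(inj_eq (can_inj vec_mxK)) linear0 in v0 *.
Qed.

(** * Kraus maps, their duals and the Kadison-Schwarz inequality *)

Section Kraus.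
Variables (C : numClosedFieldType) (d n : nat) (K : 'I_n -> 'M[C]_d).
Hypothesis K1 : \sum_i (K i) ^t* *m K i = 1%:M.
Implicit Types A B S T X Y Z : 'M[C]_d.

Definition krausop X := \sum_i K i *m X *m (K i) ^t*.
Definition krausdual X := \sum_i (K i) ^t* *m X *m K i.

Lemma krausdual1 : krausdual 1%:M = 1%:M.
Proof. by rewrite -[RHS]K1; apply: eq_bigr => i _; rewrite mulmx1. Qed.

Lemma krausdual_adj X : krausdual (X ^t*) = (krausdual X) ^t*.
Proof.
rewrite adjmx_sum; apply: eq_bigr => i _.
by rewrite !adjmxM trmxCK mulmxA.
Qed.

Lemma krausop_psdmx X : psdmx X -> psdmx (krausop X).
Proof. by move=> pX; apply: psdmx_sum => i; exact: psdmx_conj. Qed.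

Lemma krausop_dual X Y : \tr (Y *m krausop X) = \tr (krausdual Y *m X).
Proof.
rewrite /krausop /krausdual mulmx_sumr mulmx_suml !linear_sum.
by apply: eq_bigr => i _; rewrite /= !mulmxA mxtrace_mulC !mulmxA.
Qed.

(* The Kadison-Schwarz inequality for [krausdual]: the difference of the two
   sides is a sum of squares of [(Z K_i - K_i (krausdual Z)) S]. *)
Lemma krausdual_schwarz S Z : S ^t* = S ->
  hsdot (krausdual Z *m S) (krausdual Z *m S) <=
  \tr (Z ^t* *m Z *m krausop (S *m S)).
Proof.
move=> hS; rewrite krausop_dual -subr_ge0.
suff -> : \tr (krausdual (Z ^t* *m Z) *m (S *m S)) -
    hsdot (krausdual Z *m S) (krausdual Z *m S) =
    \sum_i hsdot (Z *m K i *m S - K i *m krausdual Z *m S)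
                 (Z *m K i *m S - K i *m krausdual Z *m S).
  by apply: sumr_ge0 => i _; exact: hsdotxx_ge0.
under eq_bigr do rewrite hsdotBB.
rewrite big_split !sumrB /=.
have -> : \sum_i hsdot (Z *m K i *m S) (Z *m K i *m S) =
    \tr (krausdual (Z ^t* *m Z) *m (S *m S)).
  rewrite /krausdual mulmx_suml linear_sum; apply: eq_bigr => i _.
  by rewrite /hsdot !adjmxM hS /= !mulmxA -!mulmxA mxtrace_mulC !mulmxA.
have WE : krausdual Z = \sum_i (K i) ^t* *m Z *m K i by [].
have WtE : (krausdual Z) ^t* = \sum_i (K i) ^t* *m Z ^t* *m K i.
  by rewrite -krausdual_adj.
move: (krausdual Z) WE WtE => W WE WtE.
have -> : \sum_i hsdot (Z *m K i *m S) (K i *m W *m S) =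
    hsdot (W *m S) (W *m S).
  rewrite [RHS]/hsdot adjmxM WtE.
  rewrite !(mulmx_sumr, mulmx_suml) linear_sum; apply: eq_bigr => i _.
  by rewrite /hsdot !adjmxM /= !mulmxA.
have -> : \sum_i hsdot (K i *m W *m S) (Z *m K i *m S) =
    hsdot (W *m S) (W *m S).
  rewrite [RHS]/hsdot adjmxM [X in _ *m (X *m _)]WE.
  rewrite !(mulmx_sumr, mulmx_suml) linear_sum; apply: eq_bigr => i _.
  by rewrite /hsdot !adjmxM /= !mulmxA.
have -> : \sum_i hsdot (K i *m W *m S) (K i *m W *m S) =
    hsdot (W *m S) (W *m S).
  rewrite [RHS]/hsdot -[X in _ *m X]mul1mx -K1.
  rewrite !(mulmx_sumr, mulmx_suml) linear_sum; apply: eq_bigr => i _.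
  by rewrite /hsdot !adjmxM /= !mulmxA.
by ring.
Qed.

Lemma krausop_linear : linear krausop.
Proof.
move=> a X Y; rewrite /krausop scaler_sumr -big_split; apply: eq_bigr => i _.
by rewrite mulmxDr mulmxDl -scalemxAr -scalemxAl.
Qed.

Lemma krausdual_linear : linear krausdual.
Proof.
move=> a X Y; rewrite /krausdual scaler_sumr -big_split; apply: eq_bigr => i _.
by rewrite mulmxDr mulmxDl -scalemxAr -scalemxAl.
Qed.

Lemma krausop_tr X : \tr (krausop X) = \tr X.
Proof. by rewrite -[krausop X]mul1mx krausop_dual krausdual1 mul1mx. Qed.

(** For hermitian [S] it represents the form [hsdot (S krausdual X) (krausdual Y T)], whose value at
    [X = Y = 1] is [\tr (S T)] since [krausdual] is unital. *)
Definition kraustwist S T Z := krausop (S *m krausdual Z *m T).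

Lemma hsdot_kraustwist S T X Y : S ^t* = S ->
  hsdot X (kraustwist S T Y) = hsdot (S *m krausdual X) (krausdual Y *m T).
Proof.
by move=> hS; rewrite /hsdot krausop_dual adjmxM hS krausdual_adj !mulmxA.
Qed.

Lemma kraustwist_selfadj S T X Y : S ^t* = S -> T ^t* = T ->
  hsdot X (kraustwist S T Y) = hsdot (kraustwist S T X) Y.
Proof.
move=> hS hT; rewrite [RHS]hsdotC !hsdot_kraustwist // -hsdotC /hsdot !adjmxM.
by rewrite hS hT -mulmxA mxtrace_mulC !mulmxA [in LHS]mxtrace_mulC
  !mulmxA mxtrace_mulC !mulmxA.
Qed.

(** The mean inequality separates [S krausdual X] from [krausdual Y T], and Kadison-Schwarz bounds
    each square. In the first, [S] multiplies from the left, so the bound is taken at the adjoint of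
    [X]. *)
Lemma kraustwist_le S T X Y : S ^t* = S -> T ^t* = T ->
  hsdot X (kraustwist S T Y) + hsdot (kraustwist S T Y) X <=
  \tr (X *m X ^t* *m krausop (S *m S)) + \tr (Y ^t* *m Y *m krausop (T *m T)).
Proof.
move=> hS hT; rewrite [X in _ + X]hsdotC hsdot_kraustwist // -hsdotC.
apply: le_trans (hsdot_le_mean _ _) _; apply: lerD; last first.
  exact: krausdual_schwarz.
have := krausdual_schwarz (X ^t*) hS; rewrite trmxCK; apply: le_trans.
by rewrite krausdual_adj /hsdot !adjmxM trmxCK hS mxtrace_mulC.
Qed.

End Kraus.

(** * Monotonicity of the affinity under Kraus maps *)

(** At a left kernel vector [v] of [Y + e], the form of [Y] and [e] times the squared norm of [v]
    are nonnegative with sum zero, so [v = 0]. *)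
Lemma psdmx_shift_inv (C : numClosedFieldType) (d : nat) (Y : 'M[C]_d) (e : C) :
  psdmx Y -> 0 < e ->
  exists J, [/\ psdmx J, J *m (Y + e%:M) = 1%:M & (Y + e%:M) *m J = 1%:M].
Proof.
move=> pY e0; set T := Y + e%:M.
have pT : psdmx T by apply: psdmxD => //; apply/psdmx_scalar/ltW.
have uT : T \in unitmx.
  rewrite -row_free_unit; apply/inj_row_free => v vT.
  have : (v *m T *m v ^t*) 0 0 = 0 by rewrite vT mul0mx mxE.
  rewrite mulmxDr mulmxDl mul_mx_scalar -scalemxAl !mxE => /eqP.
  have v_ge0 : 0 <= \sum_j v 0 j * (v ^t*) j 0.
    by apply: sumr_ge0 => i _; rewrite !mxE mul_conjC_ge0.
  have := pY.2 (v ^t*); rewrite trmxCK mxE => Y_ge0.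
  rewrite paddr_eq0 // ?mulr_ge0 // 1?ltW // => /andP[_].
  rewrite mulf_eq0 gt_eqF //= psumr_eq0 => [/allP v0|i _]; last first.
    by rewrite !mxE mul_conjC_ge0.
  apply/rowP => i; have := v0 i (mem_index_enum i).
  by rewrite !mxE mul_conjC_eq0 => /eqP.
have hJ : (invmx T) ^t* = invmx T.
  have : (invmx T) ^t* *m T ^t* = 1%:M by rewrite -adjmxM mulmxV // adjmx1.
  rewrite (psdmx_adj pT) => JT.
  by rewrite -[LHS]mulmx1 -(mulmxV uT) mulmxA JT mul1mx.
exists (invmx T); split; rewrite ?mulVmx ?mulmxV //.
(* The inverse [J] of [T] is hermitian, so [J = J T J] is a congruence of [T]. *)
rewrite -[invmx T]mulmx1 -(mulmxV uT) mulmxA -{2}hJ; exact: psdmx_conj.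
Qed.

Section Affinity.
Variables (C : numClosedFieldType) (d n : nat) (K : 'I_n -> 'M[C]_d).
Hypothesis K1 : \sum_i (K i) ^t* *m K i = 1%:M.
Variables A B : 'M[C]_d.
Hypotheses (pA : psdmx A) (pB : psdmx B).

(* Put [G = kraustwist S T], with [S], [T] the square roots of [A], [B], so that
   [\tr (G 1) = \tr (S T)], and let [X], [Y] be the square roots of the
   images of [A] and [B].  By kraustwist_le the block operator with diagonal
   [V |-> X^2 V], [V |-> V Y^2] and off-diagonal [G] is nonnegative, and [X V Y]
   is the geometric mean of its diagonal entries, hence dominates [G].  To see
   this, [Y] is made invertible as [E = Y + e], with inverse [J]; then
   [N V = G (V J) J] satisfies [|N V| <= |X V J|], and as in the proof that the
   square root is operator monotone, [V |-> X V J - N V] has no negative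
   eigenvalue. *)
Lemma affinity_krausop :
  \tr (sqrtmx A *m sqrtmx B) <=
  \tr (sqrtmx (krausop K A) *m sqrtmx (krausop K B)).
Proof.
have pX := psdmx_sqrt (krausop_psdmx K pA).
have pY := psdmx_sqrt (krausop_psdmx K pB).
have XX := sqrtmxK (krausop_psdmx K pA).
have YY := sqrtmxK (krausop_psdmx K pB).
have SS := sqrtmxK pA; have TT := sqrtmxK pB.
have hS := sqrtmx_adj pA; have hT := sqrtmx_adj pB.
move: (sqrtmx A) (sqrtmx B) (sqrtmx (krausop K A)) (sqrtmx (krausop K B))
  pX pY XX YY SS TT hS hT => S T X Y pX pY XX YY SS TT hS hT.
suff le_eps e : 0 < e -> \tr (S *m T) <= \tr (X *m Y) + e * \tr X.
  (* The bound is used at [e / (\tr X + 1)], which makes the error at most [e]; adding [1] keeps the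
     divisor positive. *)
  have trX0 := psdmx_tr_ge0 pX.
  have trX1 : 0 < \tr X + 1 by rewrite ltr_wpDl.
  apply/ler_addgt0Pr => e e0; apply: le_trans (le_eps (e / (\tr X + 1)) _) _.
    by rewrite divr_gt0.
  by rewrite lerD2l mulrAC ler_pdivrMr // ler_pM2l // lerDl.
move=> e0; have [J [pJ JE EJ]] := psdmx_shift_inv pY e0.
have hJ := psdmx_adj pJ; have hX := psdmx_adj pX.
set E := Y + e%:M in JE EJ.
have hE : E ^t* = E.
  by apply: psdmx_adj; apply: psdmxD => //; apply/psdmx_scalar/ltW.
have hsJ U V : hsdot U (V *m J) = hsdot (U *m J) V.
  by rewrite /hsdot adjmxM hJ mulmxA mxtrace_mulC !mulmxA.
pose N V := kraustwist K S T (V *m J) *m J.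
have selfN U V : hsdot U (N V) = hsdot (N U) V.
  by rewrite /N hsJ kraustwist_selfadj // [RHS]hsdotC hsJ -hsdotC.
have leN V : hsdot (N V) (N V) <= hsdot (X *m V *m J) (X *m V *m J).
  have e1 : hsdot (V *m J) (kraustwist K S T (N V *m J)) = hsdot (N V) (N V).
    by rewrite kraustwist_selfadj // hsJ.
  (* At this pair both cross terms equal the squared norm of [N V]. The second bound is at most that
     same norm because [Y^2] is below [E^2], so one copy cancels. *)
  have := kraustwist_le K1 (V *m J) (N V *m J) hS hT.
  rewrite [X in _ + X]hsdotC e1 -hsdotC SS TT -XX -YY -(mulmxA X V).
  move: (N V) (V *m J) => U W.
  have -> : \tr (W *m W ^t* *m (X *m X)) = hsdot (X *m W) (X *m W).
    rewrite /hsdot adjmxM hX [RHS]mxtrace_mulC -!mulmxA [RHS]mxtrace_mulC.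
    by rewrite !mulmxA.
  suff leU : \tr ((U *m J) ^t* *m (U *m J) *m (Y *m Y)) <= hsdot U U.
    by move=> h; rewrite -(lerD2r (hsdot U U)) (le_trans h) // lerD2l.
  have UE : U = U *m J *m E by rewrite -mulmxA JE mulmx1.
  rewrite [in leRHS]UE; move: (U *m J) => Z.
  have -> : hsdot (Z *m E) (Z *m E) = \tr (Z ^t* *m Z *m (E *m E)).
    by rewrite /hsdot adjmxM hE -mulmxA mxtrace_mulC !mulmxA.
  have pEY : psdmx (E *m E - Y *m Y).
    have -> : E *m E - Y *m Y = e *: Y + (e *: Y + (e * e)%:M).
      rewrite /E mulmxDl !mulmxDr mul_mx_scalar !mul_scalar_mx scale_scalar_mx.
      by rewrite -!addrA [LHS]addrC !addrA addrNK.
    have e_ge0 := ltW e0.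
    apply: psdmxD; first exact: psdmxZ.
    by apply: psdmxD; [exact: psdmxZ | apply/psdmx_scalar/mulr_ge0].
  have := hsdot_psdmx_ge0 Z (psdmx_scalar d ler01) pEY.
  by rewrite /hsdot mul1mx mulmxA mulmxBr linearB subr_ge0.
have linN a U V : N (a *: U + V) = a *: N U + N V.
  rewrite /N mulmxDl -scalemxAl /kraustwist krausdual_linear mulmxDr -scalemxAr.
  by rewrite mulmxDl -scalemxAl krausop_linear mulmxDl -scalemxAl.
have lin : linear (fun V => X *m V *m J - N V).
  move=> a U V; rewrite linN mulmxDr mulmxDl -scalemxAr -scalemxAl.
  by rewrite scalerBr opprD addrACA.
have XJ_ge0 V := hsdot_psdmx_ge0 V pX pJ.
have D_ge0 : 0 <= hsdot E (X *m E *m J - N E).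
  apply: (hsdot_eigen_ge0 lin) => [U V|V a ra V0 /eqP].
    by rewrite hsdotBr hsdotBl selfN hsJ /hsdot !adjmxM hX hJ !mulmxA.
  (* Substituting [N V = X V J - a V] into [leN] gives [a^2 hsdot V V <= 2 a hsdot V (X V J)]; for
     [a < 0] the left side is positive and the right side is not. *)
  rewrite subr_eq addrC -subr_eq => /eqP NV.
  have := leN V; rewrite -NV hsdotBB !hsdotZr !hsdotZl -(CrealP ra).
  rewrite [hsdot (X *m V *m J) V]hsdotC (geC0_conj (XJ_ge0 V)) !(CrealP ra).
  have V_gt0 : 0 < hsdot V V.
    rewrite lt_neqAle hsdotxx_ge0 andbT eq_sym.
    by apply: contraNneq V0 => /hsdotxx_eq0/eqP.
  move=> h; rewrite real_leNgt // ?real0 //; apply/negP => a0.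
  have aV_gt0 : 0 < a * (a * hsdot V V) by rewrite nmulr_rgt0 // nmulr_rlt0.
  have aXJ_le0 : a * hsdot V (X *m V *m J) <= 0 by rewrite nmulr_rle0.
  suff /(lt_le_trans aV_gt0) : a * (a * hsdot V V) <= 0 by rewrite ltxx.
  have := lerD aXJ_le0 aXJ_le0; rewrite addr0; apply: le_trans.
  rewrite -subr_ge0; move: h; rewrite -subr_ge0; congr (0 <= _).
  by ring.
(* The test matrix [E] cancels every [J]: the two terms become [\tr (X E)], which is
   [\tr (X Y) + e \tr X], and [\tr (S T)]. *)
move: D_ge0; rewrite -mulmxA EJ mulmx1 hsdotBr {1}/hsdot hE mxtrace_mulC.
rewrite mulmxDr mul_mx_scalar linearD linearZ /=.
have -> : hsdot E (N E) = \tr (S *m T).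
  rewrite /N hsJ EJ /kraustwist krausdual1 // mulmx1 /hsdot adjmx1 mul1mx.
  exact: krausop_tr.
by rewrite subr_ge0.
Qed.
End Affinity.

(** * Monotonicity of the coherence under free operations *)

(** The difference [N] of the two sides satisfies [\tr (N X) = 0] for all [X]; the adjoint of [N] is
    then taken for [X]. *)
Lemma trace_preserving_kraus (C : numClosedFieldType) (d n : nat)
    (K : 'I_n -> 'M[C]_d) :
  (forall X, \tr (krausop K X) = \tr X) -> \sum_i (K i) ^t* *m K i = 1%:M.
Proof.
move=> trK; apply/eqP; rewrite -subr_eq0; apply/eqP.
set N := _ - _; have N0 X : \tr (N *m X) = 0.
  rewrite /N mulmxBl mul1mx linearB /= -[\tr X]trK mulmx_suml !linear_sum /=.
  rewrite -sumrB big1 // => i _.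
  by rewrite [X in _ - X]mxtrace_mulC !mulmxA subrr.
by apply: hsdotxx_eq0; rewrite /hsdot mxtrace_mulC N0.
Qed.

Lemma coherence_krausop (C : numClosedFieldType) (d M n : nat)
    (P : 'I_M -> 'M[C]_d) (K : 'I_n -> 'M[C]_d) (rho : 'M[C]_d) :
  orthodec P -> \sum_i (K i) ^t* *m K i = 1%:M ->
  (forall i sigma, free_state P sigma ->
     let tau := K i *m sigma *m (K i) ^t* in
     \tr tau != 0 -> free_state P ((\tr tau)^-1 *: tau)) ->
  psdmx rho -> coherence (krausop K rho) P <= coherence rho P.
Proof.
move=> hP K1 freeK prho.
have pinchZ a X : pinching P (a *: X) = a *: pinching P X.
  rewrite /pinching scaler_sumr; apply: eq_bigr => m _.
  by rewrite -scalemxAr -scalemxAl.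
pose D := pinching P (sqrtmx rho); pose B := D *m D.
have pD : psdmx D by exact/pinching_psdmx/psdmx_sqrt.
have hD := psdmx_adj pD; have pB : psdmx B by exact: psdmx_sqr.
have sqrtB : sqrtmx B = D by exact/esym/sqrtmx_unique.
have B_fix : B = pinching P B.
  apply/(pinching_fixP hP) => m.
  by rewrite /B mulmxA pinching_comm // -!mulmxA pinching_comm.
(* Freeness speaks of normalised states with nonzero outcome trace: [B] is rescaled by its trace,
   and an outcome of trace zero is itself zero by positivity. *)
have tau_fix i : K i *m B *m (K i) ^t* = pinching P (K i *m B *m (K i) ^t*).
  have ptau := psdmx_conj (K i) pB.
  have [/(psdmx_tr_eq0 ptau) ->|tau0] := eqVneq (\tr (K i *m B *m (K i) ^t*)) 0.
    by rewrite -[0 in RHS](scale0r 0) pinchZ scale0r.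
  have B0 : \tr B != 0.
    apply: contraNneq tau0 => /(psdmx_tr_eq0 pB) ->.
    by rewrite mulmx0 mul0mx mxtrace0.
  have fsigma : free_state P ((\tr B)^-1 *: B).
    split; last by rewrite -/(pinching P _) pinchZ -B_fix.
    split; last by rewrite linearZ /= mulVf.
    by apply: psdmxZ => //; rewrite invr_ge0; exact: psdmx_tr_ge0.
  have := freeK i _ fsigma; rewrite /= -scalemxAr -scalemxAl linearZ /=.
  have Btau0 : (\tr B)^-1 * \tr (K i *m B *m (K i) ^t*) != 0.
    by rewrite mulf_neq0 // invr_eq0.
  move=> /(_ Btau0)[_].
  rewrite -/(pinching P _) !pinchZ.
  by move/scalerI => /(_ (invr_neq0 Btau0))/scalerI; apply; rewrite invr_neq0.
have PhiB_fix : krausop K B = pinching P (krausop K B).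
  apply/(pinching_fixP hP) => m; rewrite /krausop mulmx_sumr mulmx_suml.
  by apply: eq_bigr => i _; have /(pinching_fixP hP) := tau_fix i.
have pPhiB := krausop_psdmx K pB; have pPhi := krausop_psdmx K prho.
have E_fix := sqrtmx_pinching_fix hP pPhiB PhiB_fix.
have := affinity_krausop K1 prho pB; rewrite !coherenceE // lerD2l lerN2.
have := hsdot_sqrtmx pPhiB; rewrite krausop_tr // sqrtB -/D.
have hE := sqrtmx_adj pPhiB; have hX := sqrtmx_adj pPhi.
have hS := sqrtmx_adj prho.
have : \tr (sqrtmx rho *m D) = hsdot D (sqrtmx rho).
  by rewrite -{1}hS -/(hsdot _ _) /D hsdot_pinchingr.
have : \tr B = hsdot D (sqrtmx rho).
  by rewrite /D -hsdot_pinching // -/D /hsdot hD.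
move: (sqrtmx (krausop K rho)) (sqrtmx (krausop K B)) E_fix hE hX.
move=> X E E_fix hE hX -> -> EE leXE.
(* The mean inequality is taken at the pinched [X], so that its norm is the one in the coherence; as
   [E] is block diagonal, the cross terms remain [\tr (X E)]. *)
have := hsdot_le_mean (pinching P X) E.
have -> : hsdot (pinching P X) E = \tr (X *m E).
  by rewrite -hsdot_pinchingr // -E_fix /hsdot hX.
have -> : hsdot E (pinching P X) = \tr (X *m E).
  by rewrite hsdot_pinchingr // -E_fix /hsdot hE mxtrace_mulC.
rewrite hsdot_pinching // EE => /(le_trans (lerD leXE leXE)).
by rewrite lerD2r.
Qed.

Local Open Scope complex_scope.

Theorem mainTheorem1 (R : realType) (d M : nat) (P : 'I_M -> 'M[R[i]]_d)
    (hP : orthodec P) :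
  [/\ forall rho : 'M[R[i]]_d, is_state rho ->
        0 <= coherence rho P /\ (coherence rho P = 0 <-> free_state P rho),
      forall (rho : 'M[R[i]]_d) (Phi : {linear 'M[R[i]]_d -> 'M[R[i]]_d}),
        is_state rho -> free_operation P Phi ->
        coherence (Phi rho) P <= coherence rho P,
      forall (p1 p2 : R) (rho1 rho2 : 'M[R[i]]_d),
        0 <= p1 -> 0 <= p2 -> p1 + p2 = 1 ->
        is_state rho1 -> is_state rho2 -> orthogonal_blocks P rho1 rho2 ->
        coherence (p1%:C *: rho1 + p2%:C *: rho2) P =
          p1%:C * coherence rho1 P + p2%:C * coherence rho2 P
    & forall (N : nat) (Q : 'I_N -> 'M[R[i]]_d),
        orthodec Q -> refines Q P ->
        forall rho : 'M[R[i]]_d, is_state rho ->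
          coherence rho P <= coherence rho Q].
Proof.
split.
- by move=> rho sr; split; [exact: coherence_ge0 | exact: coherence_eq0P].
- move=> rho Phi [prho _] [[_ trPhi] [n [K [PhiK freeK]]]].
  have -> : Phi rho = krausop K rho by exact: PhiK.
  apply: coherence_krausop => //; apply: trace_preserving_kraus => X.
  by rewrite -[RHS]trPhi PhiK.
- move=> p1 p2 rho1 rho2 p1_ge0 p2_ge0 p12 [ps1 _] [ps2 _].
  by apply: coherence_block => //; rewrite ?ler0c // -rmorphD p12.
- move=> N Q hQ QP rho [prho _].
  apply: coherence_refines => // [|n|m n]; first by case: hQ.
    exact: orthodec_adj.
  exact: orthodec_mulmx.
Qed.
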